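(* Let $M$ be an $N$-function with dual $N$-function $M^*$ such that $L_M\subset L_2\subset L_{M^*}$. Let $f(\omega,u)$ be a Carath\'eodory function on $\Omega\times\mathbb{C}$ whose superposition operator $(fx)(\omega)=f(\omega,x(\omega))$ maps $L_M$ into $L_{M^*}$. Let $S$ be a linear operator defined on $L_{M^*}$ with values in the space of measurable functions on $\Omega$, and let $T:L_M\to L_{M^*}$ be a linear operator with $STx=x$ for all $x\in L_M$. Let $g\in L_M$ and put $\Phi x=Tx-f(x)-Tg$ for $x\in L_M$. Suppose that: (i) there is a real $\sigma$ with $\mathrm{Re}\,\langle Tx,x\rangle\ge\sigma\|x\|_2^2$ for all $x\in L_M$; (ii) there are constants $a,b>0$ and a $\mu$-integrable function $c(\cdot)$ on $\Omega$ with $-\mathrm{Re}\,\big(\overline{u}f(\omega,u)\big)\ge a\,M(b|u|)-c(\omega)$ for all $\omega\in\Omega$, $u\in\mathbb{C}$; (iii) $\phi$ is a positive function such that, for some $R_0>0$, $\mathcal{M}(x)\ge\phi(\|x\|)$ for all $x\in L_M$ with $\|x\|\ge R_0$. If $\sigma<0$ and $\phi$ has greater than quadratic rate of growth at infinity, i.e. $r^{-2}\phi(r)\to\infty$ as $r\to\infty$, then the Rothe condition is satisfied for all sufficiently large $R$, i.e. for all sufficiently large $R$ one has $\mathrm{Re}\,\langle\Phi x,x\rangle\ge 0$ for every $x\in L_M$ with $\|x\|=R$.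
   Context: $(\Omega,\mathfrak{A},\mu)$ is a set with a $\sigma$-algebra and a $\sigma$-additive measure $\mu$ that is finite and continuous (every set of positive measure can be divided into two sets of equal measure). An $N$-function is a convex function $M:[0,\infty)\to[0,\infty)$ with $\lim_{u\to0}M(u)/u=0$ and $\lim_{u\to\infty}M(u)/u=\infty$; its dual is $M^*(u)=\sup\{uv-M(v):0\le v<\infty\}$. The modular is $\mathcal{M}(x)=\int_\Omega M(|x(\omega)|)\,d\mu(\omega)$. The Orlicz space $L_M$ is the set of measurable functions $x$ with $\mathcal{M}(x/\lambda)<\infty$ for some $\lambda>0$ (similarly $L_{M^*}$). The norm $\|\cdot\|$ on $L_M$ is the Luxemburg norm $\|x\|=\inf\{\lambda>0:\mathcal{M}(x/\lambda)\le1\}$; $\|\cdot\|_2$ is the $L_2(\Omega,\mu)$-norm. The inclusion $L_M\subset L_2$ implies $\|x\|_2\le\gamma\|x\|$ for some constant $\gamma>0$ and all $x\in L_M$. The coupling of $L_{M^*}$ and $L_M$ is $\langle y,x\rangle=\int_\Omega y(\omega)\overline{x(\omega)}\,d\mu(\omega)$. Functions are complex-valued. A Carath\'eodory function $f(\omega,u)$ is measurable in $\omega$ for each $u$ and continuous in $u$ for almost every $\omega$. *)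

(* Defs.v *)
From HB Require Import structures.
From mathcomp Require Import all_boot all_order all_algebra.
From mathcomp Require Import all_classical all_reals all_analysis.
From mathcomp Require Import complex.

Set Implicit Arguments.
Unset Strict Implicit.
Unset Printing Implicit Defensive.

Import Order.TTheory GRing.Theory Num.Theory.
Import numFieldNormedType.Exports.

Local Open Scope classical_set_scope.
Local Open Scope ring_scope.
Local Open Scope complex_scope.

(* An N-function is a function on [0, +oo[: the values of [M : R -> R] at
   negative reals are irrelevant everywhere below. *)
Section N_function.
Context (R : realType).

Definition N_function (M : R -> R) : Prop :=
  [/\ forall u, 0 <= u -> 0 <= M u,
      convex_function (`[0, +oo[ : set R^o) M,
      M u / u @[u --> 0^'+] --> 0
    & M u / u @[u --> +oo] --> +oo].

(* For an N-function [M] the supremum is over a nonempty bounded set, because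
   [M] grows superlinearly. *)
Definition dualN (M : R -> R) (u : R) : R :=
  sup [set u * v - M v | v in `[0, +oo[].

End N_function.

(* Elements of the function spaces are represented by genuine functions
   [Omega -> R[i]], and the identification of functions that agree almost
   everywhere is made explicit: an operator between spaces of classes is given
   by its action on representatives, which has to be compatible with [ae_eq]. *)
Section function_spaces.
Context d (Omega : measurableType d) (R : realType).
Variable mu : {measure set Omega -> \bar R}.

Implicit Types (M : R -> R) (x y : Omega -> R[i]).

Definition continuous_measure : Prop :=
  forall A : set Omega, measurable A -> (0 < mu A)%E ->
  exists B : set Omega, [/\ measurable B, B `<=` A & mu B = mu (A `\` B)].

Definition cmeasurable : set (Omega -> R[i]) :=
  [set x | measurable_fun [set: Omega] (fun w => complex.Re (x w)) /\
           measurable_fun [set: Omega] (fun w => complex.Im (x w))].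

Definition cintegral (h : Omega -> R[i]) : R[i] :=
  (\int[mu]_w (complex.Re (h w))) +i* (\int[mu]_w (complex.Im (h w))).

Definition coupling y x : R[i] := cintegral (fun w => y w * (x w)^*).

(* Extended-real valued: [+oo] at measurable functions outside of [L2]. *)
Definition L2norm x : \bar R :=
  Lnorm mu 2%:E (EFin \o (@Normc.normc R \o x)).

Definition L2 : set (Omega -> R[i]) :=
  [set x | cmeasurable x /\ (L2norm x < +oo)%E].

Definition modular M x : \bar R :=
  (\int[mu]_w (M (Normc.normc (x w)))%:E)%E.

Definition orlicz M : set (Omega -> R[i]) :=
  [set x | cmeasurable x /\
     exists2 l : R, 0 < l & (modular M (fun w => (x w / l%:C)%R) < +oo)%E].

Definition luxemburg M x : R :=
  inf [set l : R | 0 < l /\ (modular M (fun w => (x w / l%:C)%R) <= 1)%E].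

Definition linear_operator (E F : set (Omega -> R[i]))
    (A : (Omega -> R[i]) -> (Omega -> R[i])) : Prop :=
  [/\ forall x, E x -> F (A x),
      forall x y, E x -> E y ->
        ae_eq mu [set: Omega] x y -> ae_eq mu [set: Omega] (A x) (A y)
    & forall (k : R[i]) x y, E x -> E y ->
        ae_eq mu [set: Omega]
          (A (fun w => k * x w + y w)) (fun w => k * A x w + A y w)].

(* The ascription to [R[i]^o] selects the topology of the complex modulus. *)
Definition caratheodory (f : Omega -> R[i] -> R[i]) : Prop :=
  (forall u, cmeasurable (f ^~ u)) /\ {ae mu, forall w, continuous (f w : R[i]^o -> R[i]^o)}.

End function_spaces.

Section operators.
Context (Omega : Type) (R : realType).

Definition superposition (f : Omega -> R[i] -> R[i]) (x : Omega -> R[i]) :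
    Omega -> R[i] :=
  fun w => f w (x w).

Definition Phi (T : (Omega -> R[i]) -> (Omega -> R[i]))
    (f : Omega -> R[i] -> R[i]) (g x : Omega -> R[i]) : Omega -> R[i] :=
  fun w => T x w - superposition f x w - T g w.

End operators.

(* Main.v *)
Require Import Defs.
From HB Require Import structures.
From mathcomp Require Import all_boot all_order all_algebra.
From mathcomp Require Import all_classical all_reals all_analysis.
From mathcomp Require Import complex.
From mathcomp Require Import measurable_realfun ring lra.

Set Implicit Arguments.
Unset Strict Implicit.
Unset Printing Implicit Defensive.

Import Order.TTheory GRing.Theory Num.Theory.
Import numFieldNormedType.Exports.

Local Open Scope classical_set_scope.
Local Open Scope ring_scope.
Local Open Scope complex_scope.

(** Write r for the Luxemburg norm of x and split
    Re <Phi x, x> = Re <Tx, x> - Re <f(x), x> - Re <Tg, x>.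
    Three growth rates in r compete.

    - Re <Tx, x> is at least sigma times the squared L2-norm of x, and the
      L2-norm is dominated by the Luxemburg norm ([L2norm_le_luxemburg]); since
      sigma is negative this costs at most a multiple of r ^ 2.
    - Re <Tg, x> is at most a multiple of r, by Young's inequality
      ([coupling_linear_le]).
    - The term -Re <f(x), x> is at least a times the modular of b x, minus the
      integral of c ([superposition_coercive]).  The Luxemburg norm of b x is b r, so
      this is at least a phi(b r) - C, which beats every multiple of r ^ 2.

    The only delicate point is the domination of the L2-norm, which has to come
    out of the bare inclusion of L_M in L2 ([sqint_bounded_on_ball]).  It is
    shown by a gliding hump: were the L2-norm unbounded on the unit ball of the
    modular, there would be x_n in that ball such that p_n = 2^-(n+1) |x_n| has
    arbitrarily large L2-norm.  The modulars of the p_n are summable, so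
    sup_n p_n is a function of L_M dominating every p_n, and it cannot lie in
    L2.

    Attainment of the Luxemburg infimum is avoided: both upper bounds are derived
    from a scaling factor l <= 2 r for which x / l has modular at most 1
    ([modular_le1_near_luxemburg]). *)

(** * N-functions and Young's inequality *)

Section N_function_theory.
Context (R : realType) (M : R -> R) (M_N : N_function M).

Lemma N_function_ge0 u : 0 <= u -> 0 <= M u.
Proof. by case: M_N => + _ _ _; apply. Qed.

Lemma N_function_convex p u v : 0 <= p <= 1 -> 0 <= u -> 0 <= v ->
  M (p * u + (1 - p) * v) <= p * M u + (1 - p) * M v.
Proof.
case: M_N => _ M_conv _ _ /andP[p0 p1] u0 v0.
have := M_conv (Itv01 p0 p1) u v; rewrite !inE /= !in_itv /= !andbT.
by move=> /(_ u0 v0).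
Qed.

Lemma N_function_small_slope e d : 0 < e -> 0 < d ->
  exists2 s, 0 < s < d & M s <= e * s.
Proof.
move=> e0 d0; case: M_N => _ _ /cvgr_le /(_ _ e0) Me _.
have : \forall s \near 0^'+, 0 < s < d /\ M s <= e * s.
  near=> s; have s0 : 0 < s by near: s; exact: nbhs_right_gt.
  split; first by rewrite s0; near: s; exact: nbhs_right_lt.
  by rewrite -ler_pdivrMr//; near: s.
by move=> /filter_ex[s [? ?]]; exists s.
Unshelve. all: by end_near. Qed.

Lemma N_function_superlinear k :
  exists2 V, 0 < V & forall v, V <= v -> k * v <= M v.
Proof.
case: M_N => _ _ _ /cvgryPge /(_ k) [V0 [_ VM]].
exists (`|V0| + 1) => [|v Vv]; first by rewrite ltr_wpDl.
have v0 : 0 < v by apply: lt_le_trans Vv; rewrite ltr_wpDl.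
rewrite -ler_pdivlMr//; apply: VM.
by apply: lt_le_trans Vv; rewrite ltr_pwDr// ler_norm.
Qed.

(** By convexity between a point s near 0 and v: the slope of M at s tends to 0
    with s, so in the limit the chord may be taken from the origin, whatever the
    value of M there. *)
Lemma N_function_contract t v : 0 < t <= 1 -> 0 < v -> M (t * v) <= t * M v.
Proof.
move=> /andP[t0 t1] v0; apply/ler_addgt0Pl => e e0.
have tv0 : 0 < t * v by rewrite mulr_gt0.
have [s /andP[s0 sm] Ms] :
    exists2 s, 0 < s < Num.min 1 (t * v) & M s <= e * s.
  by apply: N_function_small_slope; rewrite // lt_min ltr01.
move: sm; rewrite lt_min => /andP[s1 stv].
have tvv : t * v <= v by rewrite ler_piMl// ltW.
have vs : 0 < v - s by lra.
pose p := (v - t * v) / (v - s).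
have p01 : 0 <= p <= 1.
  by rewrite /p divr_ge0 ?ler_pdivrMr //=; lra.
have pt : 1 - p <= t.
  have -> : 1 - p = (t * v - s) / (v - s) by rewrite /p; field; lra.
  by rewrite ler_pdivrMr//; nra.
have -> : t * v = p * s + (1 - p) * v.
  by rewrite /p; field; lra.
apply: le_trans (N_function_convex p01 (ltW s0) (ltW v0)) _.
apply: lerD; last by rewrite ler_wpM2r// N_function_ge0// ltW.
case/andP: p01 => p0 p1.
have Ms0 := N_function_ge0 (ltW s0).
by nra.
Qed.

(** Convexity on the closed half-line and M(u)/u --> 0 allow M to jump at 0, to
    a positive value M 0.  Resetting that value to 0 gives a function that is
    star-shaped and nondecreasing on the whole line, and changes the modular
    over a finite measure space by a finite amount. *)
Definition vanish0 (u : R) : R := if 0 < u then M u else 0.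

Lemma vanish0_ge0 u : 0 <= vanish0 u.
Proof. by rewrite /vanish0; case: ifP => // /ltW /N_function_ge0. Qed.

Lemma vanish0_le u : 0 <= u -> vanish0 u <= M u.
Proof. by rewrite /vanish0; case: ifP => // _ /N_function_ge0. Qed.

Lemma le_vanish0 u : 0 <= u -> M u <= vanish0 u + M 0.
Proof.
rewrite /vanish0 le_eqVlt => /predU1P[<-|u0]; first by rewrite ltxx add0r.
by rewrite u0 lerDl N_function_ge0.
Qed.

Lemma vanish0_contract t v : 0 < t <= 1 -> vanish0 (t * v) <= t * vanish0 v.
Proof.
move=> /[dup] t01 /andP[t0 _]; rewrite /vanish0 pmulr_rgt0//.
by case: ifPn => [/(N_function_contract t01)//|_]; rewrite mulr0.
Qed.

Lemma vanish0_homo : nondecreasing_fun vanish0.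
Proof.
move=> u v uv; have [u0|u0] := ltP 0 u; last first.
  by rewrite {1}/vanish0 ltNge u0 /= vanish0_ge0.
have v0 : 0 < v by exact: lt_le_trans uv.
have uv01 : 0 < u / v <= 1 by rewrite divr_gt0// ler_pdivrMr// mul1r.
rewrite -[u](@divfK _ v) ?gt_eqF//.
apply: le_trans (vanish0_contract v uv01) _.
by case/andP: uv01 => _ ?; rewrite ler_piMl// vanish0_ge0.
Qed.

(** M agrees with a monotone function away from 0. *)
Lemma measurable_N_function d (T : measurableType d) (h : T -> R) :
  measurable_fun setT h -> (forall t, 0 <= h t) ->
  measurable_fun setT (M \o h).
Proof.
move=> mh h0.
rewrite (_ : M \o h = (fun t => if 0 < h t then vanish0 (h t) else M 0)).
  apply: measurable_fun_ifT => //; first exact: measurable_fun_ltr.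
  by apply: measurableT_comp mh; exact: nondecreasing_measurable vanish0_homo.
apply/funext => t /=; rewrite /vanish0.
have [//|ht] := ltP 0 (h t).
by rewrite (_ : h t = 0)//; apply/eqP; rewrite eq_le h0 ht.
Qed.

(** Superlinearity of M is what makes the supremum defining the dual a genuine
    upper bound: past some V the expression u v - M v is nonpositive. *)
Lemma young u v : 0 <= v -> u * v <= dualN M u + M v.
Proof.
move=> v0; rewrite -lerBlDr; apply: ub_le_sup; last first.
  by exists v => //=; rewrite in_itv/= v0.
have [V V0 VM] := N_function_superlinear u.
exists (`|u| * V) => _ /= [w + <-]; rewrite in_itv /= andbT => w0.
have Mw := N_function_ge0 w0.
have [Vw|/ltW wV] := leP V w.
  rewrite (@le_trans _ _ 0)//; first by rewrite subr_le0 VM.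
  by rewrite mulr_ge0// ltW.
rewrite (@le_trans _ _ (`|u| * w))//; last by rewrite ler_wpM2l.
by rewrite lerBlDr (le_trans (ler_wpM2r w0 (ler_norm u)))// lerDl.
Qed.

(** A negative value of the dual would bound M(s) from below by a positive
    constant for all s > 0, while M(s) --> 0. *)
Lemma dualN_ge0 u : 0 <= u -> 0 <= dualN M u.
Proof.
move=> u0; rewrite leNgt; apply/negP => Mu.
have [s /andP[s0 s1] Ms] : exists2 s, 0 < s < 1 & M s <= - dualN M u / 2 * s.
  by apply: N_function_small_slope => //; lra.
have := young u (ltW s0); have : 0 <= u * s by rewrite mulr_ge0// ltW.
by nra.
Qed.

Lemma dualN_homo : nondecreasing_fun (dualN M).
Proof.
move=> u u' uu'; rewrite /(dualN M u); apply: sup_le_ub.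
  by exists (u * 0 - M 0), 0 => //=; rewrite in_itv/= lexx.
move=> _ /= [v + <-]; rewrite in_itv /= andbT => v0.
by rewrite lerBlDr (le_trans _ (young _ v0))// ler_wpM2r.
Qed.

End N_function_theory.

(** * Complex-valued functions and their square integrals *)

Section complex_functions.
Context d (Omega : measurableType d) (R : realType).
Variable mu : {measure set Omega -> \bar R}.
Implicit Types (u v : R[i]) (x y : Omega -> R[i]).

Lemma normc_sqrt u : Normc.normc u = Num.sqrt (complex.Re u ^+ 2 + complex.Im u ^+ 2).
Proof. by case: u. Qed.

Lemma normc_ge0 u : 0 <= Normc.normc u.
Proof. by rewrite normc_sqrt sqrtr_ge0. Qed.

Lemma normc_real (r : R) : 0 <= r -> Normc.normc r%:C = r.
Proof. by move=> r0; rewrite normc_sqrt /= expr0n addr0 sqrtr_sqr ger0_norm. Qed.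

Lemma normc_conj u : Normc.normc u^* = Normc.normc u.
Proof. by case: u => ? ?; rewrite !normc_sqrt /= sqrrN. Qed.

Lemma normc_div u (l : R) : 0 <= l -> Normc.normc (u / l%:C) = Normc.normc u / l.
Proof. by move=> l0; rewrite Normc.normcM Normc.normcV normc_real. Qed.

Lemma normr_Re_le u : `|complex.Re u| <= Normc.normc u.
Proof. by rewrite normc_sqrt -sqrtr_sqr ler_wsqrtr// lerDl sqr_ge0. Qed.

Lemma Re_mul_conj u v :
  complex.Re (u * v^*) = complex.Re u * complex.Re v + complex.Im u * complex.Im v.
Proof. by case: u v => [? ?] [? ?] /=; rewrite mulrN opprK. Qed.

Lemma normr_Re_mul_conj u v :
  `|complex.Re (u * v^*)| <= Normc.normc u * Normc.normc v.
Proof. by rewrite (le_trans (normr_Re_le _))// Normc.normcM normc_conj. Qed.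

Lemma measurable_normc x : cmeasurable x ->
  measurable_fun setT (@Normc.normc R \o x).
Proof.
move=> [mre mim].
rewrite (_ : _ \o _ =
  (@Num.sqrt R \o (fun w => complex.Re (x w) ^+ 2 + complex.Im (x w) ^+ 2))).
  apply: measurableT_comp => //.
    by apply: nondecreasing_measurable => // ? ?; exact: ler_wsqrtr.
  by apply: measurable_funD; exact: measurable_funX.
by apply/funext => w; rewrite /= normc_sqrt.
Qed.

Lemma measurable_Re_mul_conj y x : cmeasurable y -> cmeasurable x ->
  measurable_fun setT (fun w => complex.Re (y w * (x w)^*)).
Proof.
move=> [yr yi] [xr xi]; under eq_fun do rewrite Re_mul_conj.
by apply: measurable_funD; exact: measurable_funM.
Qed.

Lemma cmeasurable_real (h : Omega -> R) : measurable_fun setT h ->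
  cmeasurable (fun w => (h w)%:C).
Proof. by move=> mh; split => //=; exact: measurable_cst. Qed.

Lemma Re_couplingE y x :
  complex.Re (coupling mu y x) = \int[mu]_w complex.Re (y w * (x w)^*).
Proof. by []. Qed.

(** The squared L2-norm before the square root is taken; scaling and comparison
    are then read off the integrand. *)
Definition sqint x : \bar R := (\int[mu]_w ((Normc.normc (x w)) ^+ 2)%:E)%E.

Lemma L2norm_sqr x : (L2norm mu x `^ 2)%E = sqint x.
Proof.
rewrite /L2norm poweR_Lnorm//; apply: eq_integral => w _ /=.
by rewrite ger0_norm ?normc_ge0// powR_mulrn// normc_ge0.
Qed.

Lemma L2_sqint_lty x : L2 mu x -> (sqint x < +oo)%E.
Proof. by move=> [_ ?]; rewrite -L2norm_sqr poweR_lty. Qed.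

Lemma fine_L2norm_sqr_le x (r : R) : L2 mu x -> (sqint x <= r%:E)%E ->
  fine (L2norm mu x) ^+ 2 <= r.
Proof.
move=> [_ x2]; rewrite -L2norm_sqr.
have : L2norm mu x \is a fin_num by rewrite ge0_fin_numE ?Lnorm_ge0.
have : (0 <= L2norm mu x)%E by rewrite Lnorm_ge0.
case: (L2norm mu x) => // s; rewrite lee_fin => s0 _.
by rewrite poweR_EFin lee_fin powR_mulrn.
Qed.

End complex_functions.

(** * The coupling of an Orlicz space with its dual *)

Section holder.
Context d (Omega : measurableType d) (R : realType).
Variable mu : {measure set Omega -> \bar R}.
Context (M : R -> R) (M_N : N_function M).
Implicit Types (x y : Omega -> R[i]).

Lemma measurable_modular x (l : R) : 0 < l -> cmeasurable x ->
  measurable_fun setT (fun w => M (Normc.normc (x w / l%:C))).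
Proof.
move=> l0 mx.
under eq_fun do rewrite normc_div ?ltW//.
apply: (measurable_N_function M_N (h := fun w => Normc.normc (x w) / l)).
  by apply: measurable_funM => //; exact: measurable_normc.
by move=> w; rewrite divr_ge0 ?normc_ge0// ltW.
Qed.

Lemma measurable_modular_dual y (l : R) : 0 < l -> cmeasurable y ->
  measurable_fun setT (fun w => dualN M (Normc.normc (y w / l%:C))).
Proof.
move=> l0 my.
under eq_fun do rewrite normc_div ?ltW//.
apply: (measurableT_comp (f := dualN M)).
  exact: nondecreasing_measurable (dualN_homo M_N).
by apply: measurable_funM => //; exact: measurable_normc.
Qed.

(** Young's inequality applied pointwise to |y| / k and |x| / l. *)
Lemma young_integral y x (k l : R) : 0 < k -> 0 < l ->
  cmeasurable y -> cmeasurable x ->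
  (\int[mu]_w (`|complex.Re (y w * (x w)^*)%R|)%:E <=
   (k * l)%:E * (modular mu (dualN M) (fun w => (y w / k%:C)%R) +
                 modular mu M (fun w => (x w / l%:C)%R)))%E.
Proof.
move=> k0 l0 my mx.
have kl0 : 0 <= k * l by rewrite mulr_ge0// ltW.
have My w : 0 <= dualN M (Normc.normc (y w / k%:C)).
  by rewrite dualN_ge0// normc_ge0.
have Mx w : 0 <= M (Normc.normc (x w / l%:C)).
  by rewrite N_function_ge0// normc_ge0.
have mMy := measurable_modular_dual k0 my.
have mMx := measurable_modular l0 mx.
rewrite /modular -ge0_integralD//; last 4 first.
- by move=> w _; rewrite lee_fin.
- exact/measurable_EFinP.
- by move=> w _; rewrite lee_fin.
- exact/measurable_EFinP.
rewrite -ge0_integralZl_EFin//; last 2 first.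
- by move=> w _; rewrite adde_ge0// lee_fin.
- by apply: emeasurable_funD; exact/measurable_EFinP.
apply: ge0_le_integral => //.
- apply/measurable_EFinP; apply: measurableT_comp => //.
  exact: measurable_Re_mul_conj.
- apply: measurable_funeM.
  by apply: emeasurable_funD; exact/measurable_EFinP.
move=> w _; rewrite -EFinD -EFinM lee_fin.
apply: le_trans (normr_Re_mul_conj _ _) _.
have := young M_N (Normc.normc (y w / k%:C)) (normc_ge0 (x w / l%:C)).
rewrite !normc_div ?(ltW k0, ltW l0)// => /(ler_wpM2l kl0).
by congr (_ <= _); field; rewrite !gt_eqF.
Qed.

Lemma integrable_coupling y x : orlicz mu (dualN M) y -> orlicz mu M x ->
  mu.-integrable setT (EFin \o (fun w => complex.Re (y w * (x w)^*))).
Proof.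
move=> [my [k k0 yk]] [mx [l l0 xl]]; apply/integrableP; split.
  exact/measurable_EFinP/measurable_Re_mul_conj.
apply: le_lt_trans (young_integral k0 l0 my mx) _.
by rewrite lte_mul_pinfty ?lee_fin ?mulr_ge0 ?ltW// lte_add_pinfty.
Qed.

Lemma coupling_bounded y : orlicz mu (dualN M) y ->
  exists2 K, 0 <= K & forall x l, 0 < l -> orlicz mu M x ->
    (modular mu M (fun w => (x w / l%:C)%R) <= 1)%E ->
    `|complex.Re (coupling mu y x)| <= K * l.
Proof.
move=> /[dup] yO [my [k k0 yk]].
pose D := modular mu (dualN M) (fun w => (y w / k%:C)%R).
have D0 : (0 <= D)%E.
  by apply: integral_ge0 => w _; rewrite lee_fin dualN_ge0// normc_ge0.
have Dfin : D \is a fin_num by rewrite ge0_fin_numE.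
exists (k * (fine D + 1)).
  by rewrite mulr_ge0 ?addr_ge0 ?fine_ge0// ltW.
move=> x l l0 xO xl; have xy_int := integrable_coupling yO xO.
rewrite Re_couplingE; apply: le_trans (le_normr_Rintegral _ xy_int) _ => //.
rewrite -lee_fin /Rintegral fineK; last first.
  apply: integrable_fin_num => //.
  by have /integrable_norm := xy_int.
apply: le_trans (young_integral k0 l0 my xO.1) _.
rewrite (_ : (k * (fine D + 1) * l)%:E = ((k * l)%:E * (D + 1))%E); last first.
  by rewrite mulrAC EFinM EFinD fineK.
by apply: lee_wpmul2l; [rewrite lee_fin mulr_ge0// ltW|exact: leeD2l].
Qed.

End holder.

(** * Boundedness of the inclusion into L2 *)

Section luxemburg_L2.
Context d (Omega : measurableType d) (R : realType).
Variable mu : {finite_measure set Omega -> \bar R}.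
Context (M : R -> R) (M_N : N_function M).
Implicit Types (x : Omega -> R[i]).

Lemma measurable_vanish0 (p : Omega -> R) : measurable_fun setT p ->
  measurable_fun setT (EFin \o vanish0 M \o p).
Proof.
move=> mp; apply: measurableT_comp => //; apply: measurableT_comp => //.
exact: nondecreasing_measurable (vanish0_homo M_N).
Qed.

(** The function h is half of the pointwise supremum of the p n.  The factor 2
    makes some p n exceed h strictly wherever h > 0, so that monotonicity alone
    bounds M(h) by one term of the series, without any continuity of M.  Where
    the supremum is infinite, h is 0 because [fine] sends +oo to 0; superlinearity
    of M and the finite integral of the series confine this to a null set. *)
Lemma orlicz_sup (p : nat -> Omega -> R) :
  (forall n, measurable_fun setT (p n)) -> (forall n w, 0 <= p n w) ->
  (\sum_(0 <= n <oo) \int[mu]_w (vanish0 M (p n w))%:E < +oo)%E ->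
  exists h : Omega -> R, [/\ measurable_fun setT h, forall w, 0 <= h w,
    (\int[mu]_w (vanish0 M (h w))%:E < +oo)%E &
    {ae mu, forall w, forall n, p n w <= 2 * h w}].
Proof.
move=> mp p0 psum.
pose G w := (\sum_(0 <= n <oo) (vanish0 M (p n w))%:E)%E.
have G_ge n w : ((vanish0 M (p n w))%:E <= G w)%E.
  rewrite /G (@nneseriesD1 _ _ n)//; last first.
    by move=> k _; rewrite lee_fin vanish0_ge0.
  rewrite leeDl//; apply: nneseries_ge0 => k _ _.
  by rewrite lee_fin vanish0_ge0.
have G0 w : (0 <= G w)%E by apply: le_trans (G_ge 0%N w); rewrite lee_fin vanish0_ge0.
have mG : measurable_fun setT G.
  apply: (ge0_emeasurable_sum (h := fun n w => (vanish0 M (p n w))%:E)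
    (P := xpredT)).
    by move=> *; rewrite lee_fin vanish0_ge0.
  by move=> n _; exact: measurable_vanish0.
have Gint : (\int[mu]_w G w < +oo)%E.
  rewrite integral_nneseries//.
  - by move=> n; exact: measurable_vanish0.
  - by move=> *; rewrite lee_fin vanish0_ge0.
pose X w := esups (fun n => (p n w)%:E) 0.
have X_ge n w : ((p n w)%:E <= X w)%E.
  by apply: ereal_sup_ubound; exists n.
have X0 w : (0 <= X w)%E by apply: le_trans (X_ge 0%N w); rewrite lee_fin.
have mX : measurable_fun setT X.
  by apply: measurable_fun_esups => n; apply: measurableT_comp.
exists (fun w => fine (X w) / 2); split.
- by apply: measurable_funM => //; exact: measurableT_comp.
- by move=> w; rewrite divr_ge0// fine_ge0.
- apply: le_lt_trans Gint; apply: ge0_le_integral => //.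
  + by move=> w _; rewrite lee_fin vanish0_ge0.
  + apply: measurable_vanish0.
    by apply: measurable_funM => //; exact: measurableT_comp.
  move=> w _; have [Xw|Xw] := ltP 0 (fine (X w)); last first.
    by rewrite /vanish0 ltNge ler_pdivrMr// mul0r Xw.
  have [n pn] : exists n, fine (X w) / 2 < p n w.
    apply: contrapT => /forallNP pX.
    have : (X w <= (fine (X w) / 2)%:E)%E.
      apply: ge_ereal_sup => _ [n _ <-].
      by rewrite lee_fin leNgt; apply/negP/pX.
    move: Xw; case: (X w) => [r||] //=; rewrite ?ltxx//.
    by rewrite lee_fin; lra.
  apply: le_trans (G_ge n w).
  by rewrite lee_fin; apply: vanish0_homo => //; exact: ltW.
- have : mu.-integrable setT G.
    apply/integrableP; split => //.
    by under eq_integral do rewrite gee0_abs//.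
  move=> /(integrable_ae measurableT); apply: filterS => w /(_ I) Gw n.
  have [V V0 VM] := N_function_superlinear M_N 1.
  have Xfin : X w \is a fin_num.
    rewrite ge0_fin_numE//.
    apply: (@le_lt_trans _ _ (Num.max V (fine (G w)))%:E); last exact: ltry.
    apply: ge_ereal_sup => _ [k _ <-]; rewrite lee_fin le_max.
    have [//|Vp] := leP (p k w) V.
    rewrite -lee_fin fineK//; apply: le_trans (G_ge k w).
    rewrite lee_fin /vanish0 (lt_trans V0 Vp).
    by rewrite -[leLHS]mul1r VM// ltW.
  by rewrite mulrC divfK// -lee_fin fineK.
Qed.

Lemma orlicz_real (h : Omega -> R) : measurable_fun setT h ->
  (forall w, 0 <= h w) -> (\int[mu]_w (vanish0 M (h w))%:E < +oo)%E ->
  orlicz mu M (fun w => (h w)%:C).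
Proof.
move=> mh h0 hfin; split; first exact: cmeasurable_real.
exists 1 => //.
have M0 : 0 <= M 0 by exact: N_function_ge0.
apply: (@le_lt_trans _ _ (\int[mu]_w ((vanish0 M (h w))%:E + (M 0)%:E)))%E.
  apply: ge0_le_integral => //.
  - by move=> w _; rewrite lee_fin N_function_ge0// normc_ge0.
  - apply/measurable_EFinP.
    apply: (measurable_modular M_N (x := fun w => (h w)%:C) ltr01).
    exact: cmeasurable_real.
  - by apply: emeasurable_funD => //; exact: measurable_vanish0.
  move=> w _; rewrite normc_div// divr1 normc_real// -EFinD lee_fin.
  exact: le_vanish0.
rewrite ge0_integralD//; last 2 first.
- by move=> w _; rewrite lee_fin vanish0_ge0.
- exact: measurable_vanish0.
by rewrite lte_add_pinfty// integral_cst// ltey_eq fin_numM// fin_num_measure.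
Qed.

Lemma integral_vanish0_le_modular x : cmeasurable x ->
  (\int[mu]_w (vanish0 M (Normc.normc (x w)))%:E <= modular mu M x)%E.
Proof.
move=> mx; apply: ge0_le_integral => //.
- by move=> w _; rewrite lee_fin vanish0_ge0.
- by apply: measurable_vanish0; exact: measurable_normc.
- apply/measurable_EFinP; apply: measurable_N_function => //.
    exact: measurable_normc.
  by move=> w; exact: normc_ge0.
by move=> w _; rewrite lee_fin vanish0_le// normc_ge0.
Qed.

(** Gliding hump: with weights c n = 2^-(n+1), elements x n of the modular unit
    ball whose square integrals exceed n / (c n) ^ 2 would give p n = c n |x n|
    with summable modulars and square integrals at least n, all dominated by
    2 h for a single h in L_M, hence in L2. *)
Lemma sqint_bounded_on_ball : orlicz mu M `<=` L2 mu ->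
  exists2 C, 0 <= C & forall x, cmeasurable x -> (modular mu M x <= 1)%E ->
    (sqint mu x <= C%:E)%E.
Proof.
move=> LM_L2; apply: contrapT => unb.
have : forall n : nat, exists x, [/\ cmeasurable x, (modular mu M x <= 1)%E &
    ((n%:R * (2 ^ n.+1)%:R ^+ 2)%:E < sqint mu x)%E].
  move=> n; apply: contrapT => /forallNP nox; apply: unb.
  exists (n%:R * (2 ^ n.+1)%:R ^+ 2); first by rewrite mulr_ge0// sqr_ge0.
  move=> x mx x1; rewrite leNgt; apply/negP => nx.
  by apply: (nox x); split.
move=> /choice[x xP].
pose c n : R := ((2 ^ n.+1)%:R)^-1.
have c0 n : 0 < c n by rewrite invr_gt0 ltr0n expn_gt0.
pose p n w := c n * Normc.normc (x n w).
have p0 n w : 0 <= p n w by rewrite mulr_ge0 ?normc_ge0// ltW.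
have mnx n : measurable_fun setT (@Normc.normc R \o x n).
  by apply: measurable_normc; case: (xP n).
have mp n : measurable_fun setT (p n).
  by apply: measurable_funM => //; exact: mnx.
have psum : (\sum_(0 <= n <oo) \int[mu]_w (vanish0 M (p n w))%:E < +oo)%E.
  apply: (@le_lt_trans _ _ 1%:E); last exact: ltry.
  apply: le_trans (epsilon_trick0 xpredT (@ler01 R)).
  apply: lee_nneseries => n _.
    by move=> _; apply: integral_ge0 => w _; rewrite lee_fin vanish0_ge0.
  case: (xP n) => mx x1 _.
  apply: (@le_trans _ _
    (\int[mu]_w ((c n)%:E * (vanish0 M (Normc.normc (x n w)))%:E)))%E.
    apply: ge0_le_integral => //.
    - by move=> w _; rewrite lee_fin vanish0_ge0.
    - exact: measurable_vanish0 (mp n).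
    - by apply: measurable_funeM; exact: measurable_vanish0 (mnx n).
    move=> w _; rewrite -EFinM lee_fin; apply: vanish0_contract => //.
    by rewrite c0 invf_le1 ?ler1n ?ltr0n ?expn_gt0.
  rewrite ge0_integralZl_EFin ?(ltW (c0 n))//; last 2 first.
  - by move=> w _; rewrite lee_fin vanish0_ge0.
  - exact: measurable_vanish0 (mnx n).
  rewrite mul1r -[leRHS]mule1; apply: lee_wpmul2l; first by rewrite lee_fin ltW.
  exact: le_trans (integral_vanish0_le_modular mx) x1.
have [h [mh h0 hfin hp]] := orlicz_sup mp p0 psum.
have h2 := L2_sqint_lty (LM_L2 _ (orlicz_real mh h0 hfin)).
have sq_h : (sqint mu (fun w => (h w)%:C) = \int[mu]_w ((h w) ^+ 2)%:E)%E.
  by apply: eq_integral => w _; rewrite normc_real.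
pose A := fine (sqint mu (fun w => (h w)%:C)).
have A0 : (0 <= sqint mu (fun w => (h w)%:C)%R)%E.
  by apply: integral_ge0 => w _; rewrite lee_fin sqr_ge0.
have le_n n : n%:R <= 4 * A.
  case: (xP n) => mx _ /ltW nx.
  rewrite -lee_fin EFinM fineK ?ge0_fin_numE// sq_h.
  rewrite -ge0_integralZl_EFin//; last 2 first.
  - by move=> w _; rewrite lee_fin sqr_ge0.
  - by apply/measurable_EFinP; exact: measurable_funX.
  apply: (@le_trans _ _ (\int[mu]_w ((c n ^+ 2)%:E *
      (Normc.normc (x n w) ^+ 2)%:E)))%E.
    rewrite ge0_integralZl_EFin ?sqr_ge0//; last 2 first.
    - by move=> w _; rewrite lee_fin sqr_ge0.
    - by apply/measurable_EFinP; apply: measurable_funX; exact: mnx.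
    have -> : n%:R = c n ^+ 2 * (n%:R * (2 ^ n.+1)%:R ^+ 2) :> R.
      by rewrite mulrCA -exprMn mulVf ?expr1n ?mulr1// pnatr_eq0 expn_eq0.
    by rewrite EFinM; apply: lee_wpmul2l => //; rewrite lee_fin sqr_ge0.
  apply: ae_ge0_le_integral => //.
  - by move=> w _; rewrite -EFinM lee_fin mulr_ge0// sqr_ge0.
  - apply: measurable_funeM; apply/measurable_EFinP.
    by apply: measurable_funX; exact: mnx.
  - by move=> w _; rewrite -EFinM lee_fin mulr_ge0// sqr_ge0.
  - by apply: measurable_funeM; apply/measurable_EFinP; exact: measurable_funX.
  apply: filterS hp => w /(_ n) pn _; rewrite -!EFinM lee_fin -exprMn.
  have -> : 4 * h w ^+ 2 = (2 * h w) ^+ 2 by ring.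
  by rewrite ler_sqr// nnegrE ?p0// mulr_ge0.
have := le_n (Num.bound (4 * A)).
by rewrite leNgt archi_boundP// mulr_ge0// fine_ge0.
Qed.

End luxemburg_L2.

(** * Homogeneity of the Luxemburg norm *)

Section luxemburg_norm.
Context d (Omega : measurableType d) (R : realType).
Variable mu : {measure set Omega -> \bar R}.
Context (M : R -> R).
Implicit Types (x : Omega -> R[i]).

Lemma modular_scale x (b l : R) : 0 < b -> 0 < l ->
  modular mu M (fun w => (b%:C * x w / l%:C)%R) =
  modular mu M (fun w => (x w / (l / b)%:C)%R).
Proof.
move=> b0 l0; apply: eq_integral => w _.
rewrite !normc_div ?divr_ge0 ?ltW// Normc.normcM normc_real ?ltW//.
by congr (M _)%:E; field; rewrite !gt_eqF.
Qed.

(** Multiplication by b is a bijection between the scaling factors admissible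
    for x and those admissible for b x; if there are none, both sides are 0. *)
Lemma luxemburg_scale x (b : R) : 0 < b ->
  luxemburg mu M (fun w => b%:C * x w) = b * luxemburg mu M x.
Proof.
move=> b0; rewrite /luxemburg.
set A := [set l | _]; set B := [set l | _].
have AB l : A l -> B (l / b).
  by move=> [l0 Al]; split; [exact: divr_gt0|rewrite -modular_scale].
have BA l : B l -> A (b * l).
  move=> [l0 Bl]; split; first exact: mulr_gt0.
  by rewrite modular_scale ?mulr_gt0// mulrAC divff ?gt_eqF// mul1r.
have lA : has_lbound A by exists 0 => l [/ltW].
have lB : has_lbound B by exists 0 => l [/ltW].
have [B0|/set0P B0] := eqVneq B set0.
  suff -> : A = set0 by rewrite B0 inf0 mulr0.
  by apply/eqP; apply: contraT => /set0P[l /AB]; rewrite B0.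
have A0 : A !=set0 by case: B0 => l /BA; exists (b * l).
apply/eqP; rewrite eq_le; apply/andP; split.
  rewrite -ler_pdivrMl//; apply: lb_le_inf => // l /BA Al.
  by rewrite ler_pdivrMl// ge_inf.
apply: lb_le_inf => // l /AB Bl.
by rewrite mulrC -ler_pdivlMr// ge_inf.
Qed.

Lemma orlicz_scale x (b : R) : 0 < b -> orlicz mu M x ->
  orlicz mu M (fun w => b%:C * x w).
Proof.
move=> b0 [[mre mim] [l l0 xl]]; split; last first.
  exists (b * l); first exact: mulr_gt0.
  by rewrite modular_scale ?mulr_gt0// mulrAC divff ?gt_eqF// mul1r.
split.
- rewrite (_ : (fun w => _) = (fun w => b * complex.Re (x w))).
    exact: measurable_funM.
  by apply/funext => w; case: (x w) => ? ? /=; rewrite mul0r subr0.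
- rewrite (_ : (fun w => _) = (fun w => b * complex.Im (x w))).
    exact: measurable_funM.
  by apply/funext => w; case: (x w) => ? ? /=; rewrite mul0r addr0.
Qed.

(** When no l > 0 is admissible the infimum is taken over the empty set and
    equals 0, so a positive norm supplies admissible scaling factors. *)
Lemma modular_le1_near_luxemburg x : 0 < luxemburg mu M x ->
  exists l, [/\ 0 < l, l <= 2 * luxemburg mu M x &
    (modular mu M (fun w => (x w / l%:C)%R) <= 1)%E].
Proof.
move=> x0; rewrite /luxemburg; set A := [set l | _].
have A0 : A !=set0.
  apply/set0P; apply: contraTN x0 => /eqP A0.
  by rewrite /luxemburg -/A A0 inf0 ltxx.
have [|l [l0 xl] lt] := @inf_lt _ A (2 * luxemburg mu M x) A0.
  by rewrite -/(luxemburg mu M x); lra.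
by exists l; split => //; exact: ltW.
Qed.

End luxemburg_norm.

(** * Estimates of the three terms and the Rothe condition *)

Section rothe.
Context d (Omega : measurableType d) (R : realType).
Variable mu : {finite_measure set Omega -> \bar R}.
Context (M : R -> R) (M_N : N_function M).
Implicit Types (x y : Omega -> R[i]).

Lemma L2norm_le_luxemburg : orlicz mu M `<=` L2 mu ->
  exists2 C, 0 <= C & forall x, orlicz mu M x -> 0 < luxemburg mu M x ->
    fine (L2norm mu x) ^+ 2 <= C * luxemburg mu M x ^+ 2.
Proof.
move=> LM_L2; have [C C0 CP] := sqint_bounded_on_ball M_N LM_L2.
exists (4 * C) => [|x xO x0]; first by rewrite mulr_ge0.
apply: fine_L2norm_sqr_le; first exact: LM_L2.
have [l [l0 lx xl]] := modular_le1_near_luxemburg x0.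
have xlO : orlicz mu M (fun w => (l^-1)%:C * x w).
  by apply: orlicz_scale => //; rewrite invr_gt0.
have -> : (sqint mu x =
    (l ^+ 2)%:E * sqint mu (fun w => ((l^-1)%:C * x w)%R))%E.
  rewrite /sqint -ge0_integralZl_EFin ?sqr_ge0//; last 2 first.
  - by move=> w _; rewrite lee_fin sqr_ge0.
  - apply/measurable_EFinP; apply: measurable_funX.
    exact: measurable_normc xlO.1.
  apply: eq_integral => w _; rewrite -EFinM; congr EFin.
  rewrite Normc.normcM normc_real ?invr_ge0 ?ltW// exprMn exprVn mulrA.
  by rewrite divff ?mul1r// expf_neq0// gt_eqF.
apply: (@le_trans _ _ ((l ^+ 2)%:E * C%:E)%E).
  apply: lee_wpmul2l; first by rewrite lee_fin sqr_ge0.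
  apply: CP; first exact: xlO.1.
  suff -> : (modular mu M (fun w => ((l^-1)%:C * x w)%R) =
    modular mu M (fun w => (x w / l%:C)%R)) by [].
  apply: eq_integral => w _.
  by rewrite normc_div ?ltW// Normc.normcM normc_real ?invr_ge0 ?ltW// mulrC.
rewrite -EFinM lee_fin.
have : l ^+ 2 <= (2 * luxemburg mu M x) ^+ 2.
  by rewrite ler_sqr// nnegrE ?mulr_ge0// ltW.
by nra.
Qed.

Lemma coupling_linear_le y : orlicz mu (dualN M) y ->
  exists2 K, 0 <= K & forall x, orlicz mu M x -> 0 < luxemburg mu M x ->
    complex.Re (coupling mu y x) <= K * luxemburg mu M x.
Proof.
move=> yO; have [K K0 KP] := coupling_bounded M_N yO.
exists (K * 2) => [|x xO x0]; first by rewrite mulr_ge0.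
have [l [l0 lx xl]] := modular_le1_near_luxemburg x0.
apply: le_trans (ler_norm _) _; apply: le_trans (KP _ _ l0 xO xl) _.
by rewrite -mulrA ler_wpM2l.
Qed.

(** The integrand of - Re <f(x), x> is integrable by Young's inequality, so the
    pointwise bound also yields the finiteness of the modular of b x. *)
Lemma superposition_coercive (f : Omega -> R[i] -> R[i]) (a b : R)
    (c : Omega -> R) x :
  0 < a -> 0 < b -> mu.-integrable setT (EFin \o c) ->
  (forall w u, a * M (b * Normc.normc u) - c w <= - complex.Re (u^* * f w u)) ->
  orlicz mu M x -> orlicz mu (dualN M) (superposition f x) ->
  (a%:E * modular mu M (fun w => (b%:C * x w)%R) <=
   (\int[mu]_w c w - complex.Re (coupling mu (superposition f x) x))%R%:E)%E.
Proof.
move=> a0 b0 c_int f_bound xO fxO.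
have h_int := integrable_coupling M_N fxO xO.
have bxO := orlicz_scale b0 xO.
have mMbx : measurable_fun setT (fun w => M (Normc.normc (b%:C * x w))).
  apply: (measurable_N_function M_N (h := fun w => Normc.normc (b%:C * x w))).
    exact: measurable_normc bxO.1.
  by move=> w; exact: normc_ge0.
rewrite Re_couplingE -RintegralB//.
have ch_int := integrableB measurableT c_int h_int.
rewrite /Rintegral fineK; last exact: integrable_fin_num ch_int.
rewrite /modular -ge0_integralZl_EFin ?(ltW a0)//; last 2 first.
- by move=> w _; rewrite lee_fin N_function_ge0// normc_ge0.
- exact/measurable_EFinP.
apply: ge0_le_integral => //.
- by move=> w _; rewrite mule_ge0 ?lee_fin ?(ltW a0)// N_function_ge0// normc_ge0.
- by apply: measurable_funeM; exact/measurable_EFinP.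
- exact: measurable_int ch_int.
move=> w _; rewrite -EFinM lee_fin Normc.normcM normc_real ?(ltW b0)//.
have := f_bound w (x w); rewrite /superposition [_^* * _]mulrC.
by lra.
Qed.

Lemma Re_couplingB2 y1 y2 y3 x : orlicz mu M x ->
  orlicz mu (dualN M) y1 -> orlicz mu (dualN M) y2 -> orlicz mu (dualN M) y3 ->
  complex.Re (coupling mu (fun w => y1 w - y2 w - y3 w) x) =
  complex.Re (coupling mu y1 x) - complex.Re (coupling mu y2 x)
    - complex.Re (coupling mu y3 x).
Proof.
move=> xO y1O y2O y3O; rewrite !Re_couplingE.
have i1 := integrable_coupling M_N y1O xO.
have i2 := integrable_coupling M_N y2O xO.
have i3 := integrable_coupling M_N y3O xO.
rewrite -RintegralB// -RintegralB//; last exact: (integrableB measurableT i1 i2).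
by apply: eq_Rintegral => w _; rewrite !mulrBl !raddfB.
Qed.

End rothe.

Theorem mainTheorem6 (R : realType) (d : measure_display)
    (Omega : measurableType d) (mu : {finite_measure set Omega -> \bar R})
    (mu_cont : continuous_measure mu)
    (M : R -> R) (M_N : N_function M)
    (LM_sub_L2 : orlicz mu M `<=` L2 mu)
    (L2_sub_LMd : L2 mu `<=` orlicz mu (dualN M))
    (f : Omega -> R[i] -> R[i]) (f_car : caratheodory mu f)
    (f_maps : forall x, orlicz mu M x -> orlicz mu (dualN M) (superposition f x))
    (S : (Omega -> R[i]) -> (Omega -> R[i]))
    (S_lin : linear_operator mu (orlicz mu (dualN M)) (@cmeasurable _ Omega R) S)
    (T : (Omega -> R[i]) -> (Omega -> R[i]))
    (T_lin : linear_operator mu (orlicz mu M) (orlicz mu (dualN M)) T)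
    (STx : forall x, orlicz mu M x -> ae_eq mu [set: Omega] (S (T x)) x)
    (g : Omega -> R[i]) (g_LM : orlicz mu M g)
    (sigma : R)
    (T_bound : forall x, orlicz mu M x ->
       sigma * fine (L2norm mu x) ^+ 2 <= complex.Re (coupling mu (T x) x))
    (a b : R) (a_gt0 : 0 < a) (b_gt0 : 0 < b)
    (c : Omega -> R) (c_int : mu.-integrable [set: Omega] (EFin \o c))
    (f_bound : forall (w : Omega) (u : R[i]),
       a * M (b * Normc.normc u) - c w <= - complex.Re (u^* * f w u))
    (phi : R -> R) (phi_gt0 : forall r, 0 < r -> 0 < phi r)
    (phi_modular : exists2 R0 : R, 0 < R0 &
       forall x, orlicz mu M x -> R0 <= luxemburg mu M x ->
       ((phi (luxemburg mu M x))%:E <= modular mu M x)%E)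
    (sigma_lt0 : sigma < 0)
    (phi_growth : r ^- 2 * phi r @[r --> +oo] --> +oo) :
  exists R1 : R, forall r : R, R1 <= r ->
    forall x, orlicz mu M x -> luxemburg mu M x = r ->
      0 <= complex.Re (coupling mu (Phi T f g x) x).
Proof.
have [C C0 CP] := L2norm_le_luxemburg M_N LM_sub_L2.
have [T_in _ _] := T_lin.
have [K K0 KP] := coupling_linear_le M_N (T_in _ g_LM).
have [R0 R0_gt0 phiP] := phi_modular.
pose C' := \int[mu]_w c w.
pose B := K + `|C'| - sigma * C.
(* B r ^ 2 bounds the sum of all unfavourable terms once r >= 1; the quotient
   below is the ratio phi(s) / s ^ 2 needed at s = b r to absorb it. *)
have /cvgryPge/(_ (B / (a * b ^+ 2)))[s0 [_ s0P]] := phi_growth.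
exists (Num.max 1 (Num.max R0 (`|s0| + 1) / b)) => r.
rewrite !ge_max => /andP[r1 r2] x xO xr.
have r0 : 0 < r by exact: lt_le_trans r1.
have {r2} /andP[R0r s0r] : (R0 <= b * r) && (`|s0| + 1 <= b * r).
  by move: r2; rewrite ler_pdivrMr// mulrC ge_max.
have br0 : 0 < b * r by rewrite mulr_gt0.
have x0 : 0 < luxemburg mu M x by rewrite xr.
have bxr : luxemburg mu M (fun w => b%:C * x w) = b * r.
  by rewrite luxemburg_scale// xr.
have fx : a * phi (b * r) <=
    C' - complex.Re (coupling mu (superposition f x) x).
  rewrite -lee_fin EFinM -bxr.
  apply: le_trans (superposition_coercive M_N a_gt0 b_gt0 c_int f_bound xO _);
    last exact: f_maps.
  apply: lee_wpmul2l; first by rewrite lee_fin ltW.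
  by apply: phiP; [exact: orlicz_scale|rewrite bxr].
have Tg := KP _ xO x0; rewrite xr in Tg.
have Tx := T_bound _ xO.
have x2 := CP _ xO x0; rewrite xr in x2.
have phi_r : B * r ^+ 2 <= a * phi (b * r).
  have : B / (a * b ^+ 2) <= (b * r) ^- 2 * phi (b * r).
    by apply: s0P; apply: lt_le_trans s0r; rewrite ltr_pwDr// ler_norm.
  rewrite ler_pdivrMr ?mulr_gt0 ?exprn_gt0// -(ler_pM2r (exprn_gt0 2 r0)).
  move=> /le_trans; apply; rewrite le_eqVlt; apply/orP; left; apply/eqP.
  by field; rewrite ?gt_eqF.
rewrite (Re_couplingB2 M_N xO (T_in _ xO) (f_maps _ xO) (T_in _ g_LM)).
have sx : sigma * (C * r ^+ 2) <= sigma * fine (L2norm mu x) ^+ 2.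
  by rewrite ler_nM2l.
have rr : r <= r ^+ 2 by rewrite expr2 ler_peMr// ltW.
have Kr : K * r <= K * r ^+ 2 by rewrite ler_wpM2l.
have Cr : C' <= `|C'| * r ^+ 2.
  rewrite (le_trans (ler_norm _))// ler_peMr//.
  by rewrite (le_trans r1).
by rewrite /B in phi_r; nra.
Qed.
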